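(* Fix $m\ge2$ and rational-coefficient probability-generating weight functions $\phi_1,\dots,\phi_k$ with $k<m$. There exist two graph snapshot sequences $\mathbf G=(G_1,\dots,G_m)$ and $\mathbf G'=(G'_1,\dots,G'_m)$ on a common (sufficiently large) finite vertex set, whose $H_1$ zigzag barcodes have different positive-lifetime histograms, but which satisfy $$F_{\phi_j}(\mathbf G)=F_{\phi_j}(\mathbf G')\qquad(1\le j\le k).$$ Moreover the sequences may be chosen with a common spanning star contained in every snapshot.
   Context: A graph snapshot sequence $\mathbf G=(G_1,\dots,G_m)$ consists of simple undirected graphs on a common vertex set, regarded as one-dimensional simplicial complexes. Its intersection zigzag is $\mathcal Z(\mathbf G): G_1\leftarrow G_1\cap G_2\rightarrow G_2\leftarrow\cdots\rightarrow G_m$ (inclusions), with snapshot nodes $G_1,\dots,G_m$. The $H_1$ zigzag barcode is the multiset of interval summands $b$ (bars) of the degree-one homology of $\mathcal Z(\mathbf G)$ over a fixed arbitrary field; the snapshot lifetime $\ell_b\in\{0,\dots,m\}$ is the number of snapshot nodes in the support of $b$. The positive-lifetime histogram is $(h_1,\dots,h_m)$, where $h_\ell$ is the number of bars with $\ell_b=\ell$. A probability-generating weight function is a polynomial $\phi(x)=\sum_{r=1}^{r_{\max}}a_rx^r$ with $a_r\ge0$ and $\sum_ra_r=1$ (no constant term); it is rational-coefficient if all $a_r\in\mathbb Q$. Put $F_\phi(\mathbf G)=\sum_b\phi(\ell_b/m)$. *)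

(* Defs.v *)
From HB Require Import structures.
From mathcomp Require Import all_boot all_order all_algebra.
Set Implicit Arguments.
Unset Strict Implicit.
Unset Printing Implicit Defensive.
Import Order.TTheory GRing.Theory Num.Theory.
Local Open Scope ring_scope.

Record sgraph (V : finType) := SGraph {
  adj :> rel V;
  adj_sym : symmetric adj;
  adj_irr : irreflexive adj
}.

Section GraphIntersection.
Variables (V : finType) (G H : sgraph V).

Fact capg_sym : symmetric [rel u v | G u v && H u v].
Proof. by move=> u v /=; rewrite (adj_sym G) (adj_sym H). Qed.

Fact capg_irr : irreflexive [rel u v | G u v && H u v].
Proof. by move=> u /=; rewrite adj_irr. Qed.

Definition capg : sgraph V := SGraph capg_sym capg_irr.

End GraphIntersection.

Definition spanning_star_in (V : finType) (c : V) (G : sgraph V) : Prop :=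
  forall v, v != c -> G c v.

Section GraphHomology.
Variables (F : fieldType) (V : finType).

(* Oriented 1-chains are stored as functions on ordered pairs of vertices; the
   oriented edge [u, v] is the function with value 1 at (u, v), -1 at (v, u),
   so that [v, u] = - [u, v], in every characteristic. *)
Definition oedge (e : V * V) : {ffun V * V -> F^o} :=
  [ffun p => (p == e)%:R - (p == (e.2, e.1))%:R].

Definition chains1 (G : sgraph V) : {vspace {ffun V * V -> F^o}} :=
  (\sum_(e : V * V | G e.1 e.2) <[oedge e]>)%VS.

(* Sends the oriented edge [u, v] to v - u, see bound1_oedge. *)
Definition bound1 (c : {ffun V * V -> F^o}) : {ffun V -> F^o} :=
  [ffun v => \sum_u c (u, v)].

Fact bound1_is_linear : linear bound1.
Proof.
move=> a c d; apply/ffunP=> v; rewrite !ffunE scaler_sumr -big_split.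
by apply: eq_bigr => u _; rewrite !ffunE.
Qed.

HB.instance Definition _ :=
  GRing.isLinear.Build F {ffun V * V -> F^o} {ffun V -> F^o} *:%R bound1
    bound1_is_linear.

Lemma bound1_oedge u v w :
  bound1 (oedge (u, v)) w = (w == v)%:R - (w == u)%:R.
Proof.
have sum_delta (a b : V) : \sum_x ((x, w) == (a, b))%:R = (w == b)%:R :> F.
  rewrite (bigD1 a) //= xpair_eqE eqxx big1 ?addr0 // => x /negPf xa.
  by rewrite xpair_eqE xa.
rewrite ffunE (eq_bigr (fun x => ((x, w) == (u, v))%:R -
  ((x, w) == (v, u))%:R)) => [|x _]; last by rewrite ffunE.
by rewrite sumrB !sum_delta.
Qed.

(* A graph has no 2-simplices, so there are no 1-boundaries to quotient by. *)
Definition H1 (G : sgraph V) : {vspace {ffun V * V -> F^o}} :=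
  (chains1 G :&: lker (linfun bound1))%VS.

End GraphHomology.

(* Even nodes 2t carry snapshot t, odd nodes 2t+1 the intersection of snapshots t
   and t+1: 0 <- 1 -> 2 <- 3 -> ... -> 2m-2. *)
Definition zarrow (i j : nat) : bool := odd i && ((i == j.+1) || (j == i.+1)).

Definition znode (m : nat) : Type := 'I_(m.*2.-1).

Record zigzag (F : fieldType) (m : nat) := Zigzag {
  zspace :> znode m -> lmodType F;
  zmap : forall i j : znode m, zarrow i j -> {linear zspace i -> zspace j}
}.

Definition ziso (F : fieldType) (m : nat) (M N : zigzag F m) : Prop :=
  exists f : forall i : znode m, {linear M i -> N i},
    (forall i, bijective (f i)) /\
    (forall (i j : znode m) (a : zarrow i j) (x : M i),
       f j (zmap M a x) = zmap N a (f i x)).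

Section DirectSum.
Variables (F : fieldType) (m : nat).

Definition pair_map (U1 V1 U2 V2 : lmodType F)
    (f : {linear U1 -> V1}) (g : {linear U2 -> V2}) (x : U1 * U2) : V1 * V2 :=
  (f x.1, g x.2).

Fact pair_map_is_linear (U1 V1 U2 V2 : lmodType F)
    (f : {linear U1 -> V1}) (g : {linear U2 -> V2}) : linear (pair_map f g).
Proof. by move=> a x y; rewrite /pair_map /= !linearP. Qed.

HB.instance Definition _ (U1 V1 U2 V2 : lmodType F)
    (f : {linear U1 -> V1}) (g : {linear U2 -> V2}) :=
  GRing.isLinear.Build F (U1 * U2)%type (V1 * V2)%type *:%R (pair_map f g)
    (pair_map_is_linear f g).

Definition zplus (M N : zigzag F m) : zigzag F m :=
  @Zigzag F m (fun i => (M i * N i)%type : lmodType F)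
    (fun i j a => pair_map (zmap M a) (zmap N a)).

Definition zzero : zigzag F m :=
  @Zigzag F m (fun=> 'rV[F]_0 : lmodType F) (fun i j a => idfun).

End DirectSum.

Record bar (m : nat) := Bar {
  bstart : znode m;
  bend : znode m;
  bstart_le_bend : (bstart <= bend)%N
}.

Definition in_bar (m : nat) (b : bar m) (i : nat) : bool :=
  (bstart b <= i <= bend b)%N.

(* The booleans are coerced to dimensions: the space at i is F if i is in b and
   0 otherwise, and a map between two copies of F is the 1 x 1 identity. *)
Definition zinterval (F : fieldType) (m : nat) (b : bar m) : zigzag F m :=
  @Zigzag F m (fun i => 'rV[F]_(in_bar b i) : lmodType F)
    (fun i j a => mulmxr (const_mx 1 : 'M[F]_(in_bar b i, in_bar b j))).

(* Multisets of bars are represented by sequences. *)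
Definition is_barcode (F : fieldType) (m : nat) (M : zigzag F m)
    (B : seq (bar m)) : Prop :=
  ziso M (foldr (fun b N => zplus (zinterval F b) N) (zzero F m) B).

Definition lifetime (m : nat) (b : bar m) : nat :=
  #|[set t : 'I_m | in_bar b t.*2]|.

(* The entry of index l : 'I_m counts the bars of lifetime l.+1. *)
Definition pos_histogram (m : nat) (B : seq (bar m)) : m.-tuple nat :=
  [tuple count (fun b => lifetime b == l.+1) B | l < m].

Section SnapshotZigzag.
Variables (F : fieldType) (V : finType) (m : nat) (G : 'I_m -> sgraph V).

Fact zlo_subproof (i : znode m) : (i./2 < m)%N.
Proof.
case: i => i /=; rewrite ltn_half_double => /leq_trans; apply.
exact: leq_pred.
Qed.

Fact zhi_subproof (i : znode m) : (uphalf i < m)%N.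
Proof.
case: i => i /=; case: (m) => // n; rewrite doubleS /= => lt_i.
by rewrite uphalfE ltn_half_double doubleS.
Qed.

Definition zlo (i : znode m) : 'I_m := Ordinal (zlo_subproof i).
Definition zhi (i : znode m) : 'I_m := Ordinal (zhi_subproof i).

Definition zgraph (i : znode m) : sgraph V :=
  if odd i then capg (G (zlo i)) (G (zhi i)) else G (zlo i).

(* Since zgraph i is a subgraph of zgraph j, the projection vsproj acts as the
   inclusion of cycle spaces, see H1_zigzagE. *)
Definition H1_zigzag : zigzag F m :=
  @Zigzag F m (fun i => subvs_of (H1 F (zgraph i)) : lmodType F)
    (fun i j a => vsproj (H1 F (zgraph j)) \o vsval).

Lemma zgraph_sub (i j : znode m) :
  zarrow i j -> subrel (zgraph i) (zgraph j).
Proof.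
case/andP=> oi /orP ij u v; rewrite /zgraph oi.
case: ij => /eqP ij.
  have ej: odd j = false by move: oi; rewrite ij /= => /negPf.
  rewrite ej /= => /andP[+ _]; congr (is_true (adj (G _) u v)).
  by apply: val_inj; rewrite /= ij /= uphalf_half ej.
have ej: odd j = false by rewrite ij /= oi.
rewrite ej /= => /andP[_ +]; congr (is_true (adj (G _) u v)).
by apply: val_inj; rewrite /= ij.
Qed.

Lemma H1_zigzagE (i j : znode m) (a : zarrow i j) (x : H1_zigzag i) :
  vsval (zmap H1_zigzag a x : subvs_of _) = vsval (x : subvs_of _).
Proof.
rewrite /= vsprojK //; apply: subvP (vsval _) (subvsP x).
apply: capvS => //; apply/subv_sumP => e Ge.
by rewrite (sumv_sup e) // (zgraph_sub a).
Qed.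

End SnapshotZigzag.

Definition pgf_weight (phi : {poly rat}) : Prop :=
  [/\ phi`_0 = 0, (forall r, 0 <= phi`_r) & \sum_(r < size phi) phi`_r = 1].

Definition weight_sum (m : nat) (phi : {poly rat}) (B : seq (bar m)) : rat :=
  \sum_(b <- B) phi.[(lifetime b)%:R / m%:R].

(* Main.v *)
From HB Require Import structures.
Require Import Defs.
From mathcomp Require Import all_boot all_order all_algebra.
From mathcomp Require Import ring zify.
Set Implicit Arguments.
Unset Strict Implicit.
Unset Printing Implicit Defensive.
Import Order.TTheory GRing.Theory Num.Theory.
Local Open Scope ring_scope.

(** Fewer than [m] linear functionals with rational coefficients on histograms
    have a common nonzero integer kernel vector [d].  Any histogram is realized
    by a star with disjoint extra edges between leaves, an edge of lifetime
    [l + 1] being present in the snapshots [0, ..., l] only: each edge closes one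
    triangle with the center, and these triangles form a basis of the cycle
    space at every node.  Take the histograms [d^+] and [d^-].

    Krull-Schmidt is not needed to see that every barcode of such a zigzag has
    this histogram.  Node dimensions are isomorphism invariants, and all arrows
    are injective, so a bar through an intersection node contains both
    neighbours; as snapshot [t + 1] has the dimension of its intersection with
    snapshot [t], no bar starts after node [0].  Hence the dimension at node
    [2 t] counts the bars of lifetime greater than [t]. *)

(** * Node dimensions and injective arrows seen through a barcode *)

Definition barsum (F : fieldType) (m : nat) (B : seq (bar m)) : zigzag F m :=
  foldr (fun b N => zplus (zinterval F b) N) (zzero F m) B.

Section Invariants.
Variables (F : fieldType) (m : nat).
Implicit Types (M : zigzag F m) (B : seq (bar m)) (i j : znode m).

Lemma leq_linear_inj (p q : nat) (h : {linear 'rV[F]_p -> 'rV[F]_q}) :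
  injective h -> (p <= q)%N.
Proof.
move=> h_inj.
have lker0: (lker (linfun h) == 0)%VS.
  by apply/lker0P => x y; rewrite !lfunE => /h_inj.
have := limg_dim_eq (f := linfun h) (U := fullv).
rewrite (eqP lker0) capv0 => /(_ erefl) d.
by have := dimvS (subvf (linfun h @: fullv)); rewrite d !dimvf /dim /= !mul1n.
Qed.

(** On a cons, [count] unfolds to [in_bar b i] plus the rest, so [row_mx] appends the coordinates of
    one interval to those of the others. *)
Lemma barsum_rV B i :
  exists h : {linear barsum F B i -> 'rV[F]_(count (fun b => in_bar b i) B)},
    bijective h.
Proof.
elim: B => [|b B [h [h' hK h'K]]].
  by exists (idfun : {linear 'rV[F]_0 -> 'rV[F]_0}); exists id.
pose g (x : barsum F (b :: B) i) :
  'rV[F]_(count (fun b => in_bar b i) (b :: B)) := row_mx x.1 (h x.2).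
have g_lin: linear g.
  by move=> a x y; rewrite /g /= (linearP h) scale_row_mx add_row_mx.
pose gL := HB.pack_for {linear _ -> _} g
  (GRing.isLinear.Build _ _ _ _ _ g_lin).
pose g' (v : 'rV[F]_(count (fun b => in_bar b i) (b :: B))) :
  barsum F (b :: B) i := (lsubmx v, h' (rsubmx v)).
exists gL; apply: (@Bijective _ _ _ g') => [[x y]|v].
  by rewrite /g' /= /g row_mxKl row_mxKr hK.
by rewrite /= /g h'K hsubmxK.
Qed.

Lemma barcode_rV M B i : is_barcode M B ->
  exists h : {linear M i -> 'rV[F]_(count (fun b => in_bar b i) B)}, bijective h.
Proof.
case=> f [f_bij _]; have [h h_bij] := barsum_rV B i.
exists (h \o f i : {linear _ -> _}); exact: bij_comp h_bij (f_bij i).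
Qed.

(** The nodes are bare modules, so dimensions are compared by inverting one coordinate isomorphism
    and composing it with the other. *)
Lemma leq_count_in_bar M B B' i : is_barcode M B -> is_barcode M B' ->
  (count (fun b => in_bar b i) B <= count (fun b => in_bar b i) B')%N.
Proof.
move=> /(barcode_rV i)[h [g hK gK]] /(barcode_rV i)[h' /bij_inj h'_inj].
pose gL := HB.pack_for {linear _ -> _} g
  (GRing.isLinear.Build _ _ _ _ _ (can2_linear hK gK)).
apply: (@leq_linear_inj _ _ (h' \o gL)).
exact: inj_comp h'_inj (can_inj gK).
Qed.

Lemma eq_count_in_bar M B B' i : is_barcode M B -> is_barcode M B' ->
  count (fun b => in_bar b i) B = count (fun b => in_bar b i) B'.
Proof.
move=> MB MB'; apply/eqP; rewrite eqn_leq.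
by rewrite (leq_count_in_bar i MB MB') (leq_count_in_bar i MB' MB).
Qed.

(** If a bar contained [i] but not [j], its generator at [i] would be a nonzero vector of the
    kernel. *)
Lemma barsum_inj B i j (a : zarrow i j) :
  injective (zmap (barsum F B) a) -> all (fun b => in_bar b i ==> in_bar b j) B.
Proof.
elim: B => //= b B IH inj_bB; apply/andP; split; last first.
  apply: IH => x y xy; suff: (0, x) = (0, y) :> barsum F (b :: B) i by case.
  by apply: inj_bB; rewrite /= /pair_map /= xy.
apply/implyP => bi; apply/negPn/negP => bj.
have: (const_mx 1, 0) = (0, 0) :> barsum F (b :: B) i.
  apply: inj_bB; rewrite /= /pair_map /=; congr (_, _).
  by apply/matrixP => u [v v_lt]; move: (v_lt); rewrite (negPf bj).
case=> /matrixP/(_ 0); rewrite bi => /(_ 0); rewrite !mxE => /eqP.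
by rewrite oner_eq0.
Qed.

Lemma barcode_inj M B i j (a : zarrow i j) : is_barcode M B ->
  injective (zmap M a) -> all (fun b => in_bar b i ==> in_bar b j) B.
Proof.
case=> f [f_bij fM] M_inj; apply: (@barsum_inj _ _ _ a) => x y.
have [fi' fiK fi'K] := f_bij i.
rewrite -(fi'K x) -(fi'K y) => xy; congr (f i _); apply: M_inj.
by apply: (bij_inj (f_bij j)); rewrite !fM.
Qed.

End Invariants.

Lemma H1_zigzag_barcode_closed (F : fieldType) (V : finType) (m : nat)
    (G : 'I_m -> sgraph V) (B : seq (bar m)) (i j : znode m) :
  is_barcode (H1_zigzag F G) B -> zarrow i j ->
  all (fun b => in_bar b i ==> in_bar b j) B.
Proof.
move=> GB a; apply: (barcode_inj (a := a) GB) => x y /(congr1 vsval).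
by rewrite !H1_zigzagE => /val_inj.
Qed.

(** * Counting in sequences, and bars that start at node 0 *)

Lemma all_forall (T : Type) (I : finType) (P : I -> pred T) (s : seq T) :
  (forall i, all (P i) s) -> all (fun x => [forall i, P i x]) s.
Proof.
elim: s => //= x s IH Ps; rewrite IH ?andbT => [|i]; last by case/andP: (Ps i).
by apply/forallP => i; case/andP: (Ps i).
Qed.

(** The count of [P] is at most that of [Q] on every tail, so equal totals leave no element in [Q]
    outside [P]. This lets equal dimensions reverse a containment. *)
Lemma all_implyb_count (T : Type) (P Q : pred T) (s : seq T) :
  all (fun x => P x ==> Q x) s -> count P s = count Q s ->
  all (fun x => Q x ==> P x) s.
Proof.
elim: s => //= x s IH /andP[PQ PQs].
have le_PQ: (count P s <= count Q s)%N.
  elim: s PQs {IH} => //= y s IH /andP[yPQ /IH].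
  by move: yPQ; case: (P y) (Q y) => [] [] //=; lia.
by move: PQ; case: (P x) (Q x) => [] [] //= _ E;
  first [by apply: IH => //; lia | lia].
Qed.

Section StartingAtZero.
Variable m : nat.
Implicit Types (B : seq (bar m)) (b : bar m) (i : znode m).

Definition zpred i : znode m :=
  Ordinal (leq_ltn_trans (leq_pred i) (ltn_ord i)).

(** Each bar contains its start, hence the predecessor of its start; this forces the start to be 0,
    which [zpred] fixes. *)
Lemma all_bstart0 B :
  (forall i, all (fun b => in_bar b i ==> in_bar b (zpred i)) B) ->
  all (fun b => bstart b == 0 :> nat)%N B.
Proof.
move=> /all_forall; apply: sub_all => b /forallP/(_ (bstart b)).
rewrite /in_bar leqnn bstart_le_bend /=; lia.
Qed.

Lemma lifetime_bstart0 b t : bstart b = 0 :> nat -> (t < m)%N ->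
  (t < lifetime b)%N = in_bar b t.*2.
Proof.
move=> b0 t_lt.
have bend_lt: ((bend b)./2.+1 <= m)%N by case: (bend b) => e /=; lia.
(* A bar from 0 to [e] meets exactly the snapshots 0, ..., [e./2]. *)
have -> : lifetime b = (bend b)./2.+1.
  have wid_inj: injective (widen_ord bend_lt).
    by move=> u v /(congr1 val)/= /val_inj.
  rewrite -[RHS]card_ord -cardsT -(card_imset _ wid_inj).
  apply: eq_card => u; rewrite inE /in_bar b0 /=.
  apply/idP/imsetP => [u_le|[v _ ->]] /=; last by case: v => v /=; lia.
  have u_lt: (u < (bend b)./2.+1)%N by lia.
  by exists (Ordinal u_lt); last exact: val_inj.
by rewrite /in_bar b0; lia.
Qed.

Lemma lifetime_le b : (lifetime b <= m)%N.
Proof. by rewrite -[leqRHS]card_ord; apply: max_card. Qed.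

(** The bars of lifetime above [t] are those over node [t.*2], and the multiplicity of [t] is a
    difference of consecutive tail counts. *)
Lemma perm_lifetime B B' : (0 < m)%N ->
  all (fun b => bstart b == 0 :> nat)%N B ->
  all (fun b => bstart b == 0 :> nat)%N B' ->
  (forall i, count (fun b => in_bar b i) B = count (fun b => in_bar b i) B') ->
  perm_eq (map (@lifetime m) B) (map (@lifetime m) B').
Proof.
move=> m_gt0 B0 B'0 eqBB'.
have count_gt C t : all (fun b => bstart b == 0 :> nat)%N C -> (t < m)%N ->
    count (fun b => t < lifetime b)%N C = count (fun b => in_bar b t.*2) C.
  move=> C0 t_lt; elim: C C0 => //= b C IH /andP[/eqP b0 /IH ->].
  by rewrite lifetime_bstart0.
have {}count_gt t : count (fun b => t < lifetime b)%N B =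
    count (fun b => t < lifetime b)%N B'.
  have [t_lt|t_ge] := ltnP t m.
    rewrite !count_gt //; have t2_lt: (t.*2 < m.*2.-1)%N by lia.
    exact: (eqBB' (Ordinal t2_lt)).
  have C0 C : count (fun b => t < lifetime b)%N C = 0%N.
    rewrite -(count_pred0 C); apply: eq_count => b /=.
    by rewrite ltnNge (leq_trans (lifetime_le b)).
  by rewrite !C0.
have count_ge t : count (fun b => t <= lifetime b)%N B =
    count (fun b => t <= lifetime b)%N B'.
  case: t => [|t]; last exact: count_gt.
  have sz C : all (fun b => bstart b == 0 :> nat)%N C ->
      count (fun b => 0 <= lifetime b)%N C =
      count (fun b => 0 < lifetime b)%N C.
    elim: C => //= b C IH /andP[/eqP b0 /IH ->].
    by rewrite lifetime_bstart0 // /in_bar b0.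
  by rewrite !sz.
have count_eq C t : (count_mem t (map (@lifetime m) C) +
   count (fun b => t < lifetime b) C = count (fun b => t <= lifetime b) C)%N.
  by elim: C => //= b C IH; case: (ltngtP (lifetime b) t) => _ /=; lia.
apply/allP => t _ /=.
rewrite -(eqn_add2r (count (fun b => t < lifetime b)%N B)).
by rewrite count_eq count_gt count_ge count_eq.
Qed.

End StartingAtZero.

(** * Cycle spaces and barcodes of a star with leaf edges *)

Section StarWithLeafEdges.
Variables (F : fieldType) (m : nat) (E : finType) (D : {set E}) (L : E -> 'I_m).

(** The vertices depend on [E] and not on [D], so different choices of [D] share a vertex set. *)
Definition star_vertex : finType := option (E * bool).
Implicit Types (u v : star_vertex) (e : E) (i j : znode m).
Let V := star_vertex.
Implicit Types c d : {ffun V * V -> F^o}.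

(* [None] is the center, and [e] in [D] is the leaf edge joining [Some (e, false)]
   to [Some (e, true)]; it is present up to snapshot [L e]. *)
Definition star_adj (t : nat) : rel V := fun u v =>
  match u, v with
  | Some (e, x), Some (e', x') => [&& e == e', x != x', e \in D & (t <= L e)%N]
  | _, _ => isSome u != isSome v
  end.

Fact star_adj_sym t : symmetric (star_adj t).
Proof.
move=> [[e x]|] [[e' x']|] //=; rewrite eq_sym [in x == x']eq_sym.
by case: eqP => // ->.
Qed.

Fact star_adj_irr t : irreflexive (star_adj t).
Proof. by move=> [[e x]|] //=; rewrite !eqxx. Qed.

Definition star_graph (t : 'I_m) : sgraph V :=
  SGraph (star_adj_sym t) (star_adj_irr t).

(** The graphs decrease with time, so an intersection node carries the later of its two snapshots,
    of index [uphalf i]. *)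
Lemma star_zgraph i u v : zgraph star_graph i u v = star_adj (uphalf i) u v.
Proof.
rewrite /zgraph; case: ifP => oi /=; last by rewrite uphalf_half oi.
case: u v => [[e x]|] [[e' x']|] //=.
case: (e == e') (x != x') (e \in D) => [] [] [] //=; apply/andP/idP => [[]//|].
by move=> le; split=> //; apply: leq_trans le; rewrite uphalf_half oi; lia.
Qed.

Lemma chains1_antisym (G : sgraph V) c u v :
  c \in chains1 F G -> c (u, v) = - c (v, u).
Proof.
case/memv_sumP => z z_in ->; rewrite !sum_ffunE -sumrN; apply: eq_bigr => e Ge.
have /vlineP[a ->] := z_in e Ge; case: e {z_in Ge} => p q; rewrite !ffunE /=.
by rewrite -scalerN opprB !xpair_eqE andbC [(v == p) && _]andbC.
Qed.

Lemma chains1_supp (G : sgraph V) c u v :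
  c \in chains1 F G -> ~~ G u v -> c (u, v) = 0.
Proof.
case/memv_sumP => z z_in -> Guv; rewrite !sum_ffunE; apply: big1 => e Ge.
have /vlineP[a ->] := z_in e Ge; case: e {z_in} Ge => p q /= Gpq.
rewrite !ffunE /= !xpair_eqE.
have /negPf-> : ~~ ((u == p) && (v == q)).
  by apply: contra Guv => /andP[/eqP-> /eqP->].
have /negPf-> : ~~ ((u == q) && (v == p)).
  by apply: contra Guv => /andP[/eqP-> /eqP->]; rewrite adj_sym.
by rewrite subrr scaler0.
Qed.

Definition leaf_edge e : V * V := (Some (e, false), Some (e, true)).

Definition triangle e : {ffun V * V -> F^o} :=
  oedge F (None, Some (e, false)) + oedge F (leaf_edge e)
    + oedge F (Some (e, true), None).

(** Coefficients on leaf edges are thus coordinates dual to the triangles. *)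
Lemma triangle_leaf_edge e e' : triangle e (leaf_edge e') = (e' == e)%:R.
Proof.
have eE x y : (Some (e', x) == Some (e, y) :> V) = (e' == e) && (x == y) by [].
by rewrite !ffunE /= !xpair_eqE !eE /= !andbT !andbF /= !subr0 add0r addr0 andbb.
Qed.

Lemma memv_oedge (G : sgraph V) p : G p.1 p.2 -> oedge F p \in chains1 F G.
Proof.
by move=> Gp; apply: subvP (memv_line _); apply: (sumv_sup p) (subvv _).
Qed.

Lemma triangle_in_H1 i e : e \in D -> (uphalf i <= L e)%N ->
  triangle e \in H1 F (zgraph star_graph i).
Proof.
move=> eD i_le; rewrite memv_cap; apply/andP; split.
  by rewrite !rpredD // memv_oedge //= star_zgraph //= !eqxx eD.
rewrite memv_ker lfunE /= !linearD; apply/eqP/ffunP => w.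
by rewrite ffunE [X in X + _]ffunE !bound1_oedge ffunE; ring.
Qed.

(** Without leaf edges the cycle lives on a star, where the boundary at a leaf is the coefficient of
    its only edge. *)
Lemma H1_star_eq0 i c : c \in H1 F (zgraph star_graph i) ->
  (forall e, c (leaf_edge e) = 0) -> c = 0.
Proof.
rewrite memv_cap memv_ker lfunE => /andP[c_ch /eqP/= c_cyc] c_leaf.
have c_SS p q : c (Some p, Some q) = 0.
  case: p q => [e x] [e' x'].
  case: (eqVneq e e') => [<-|ee']; last first.
    by apply: chains1_supp c_ch _; rewrite star_zgraph /= (negPf ee').
  case: (eqVneq x x') => [<-|].
    by apply: chains1_supp c_ch _; rewrite adj_irr.
  case: x x' => [] [] // _; last exact: c_leaf.
  by rewrite (chains1_antisym _ _ c_ch) (c_leaf e) oppr0.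
have c_NS p : c (None, Some p) = 0.
  have /ffunP/(_ (Some p)) := c_cyc.
  rewrite !ffunE (bigD1 None) //= big1 ?addr0 //.
  by case.
apply/ffunP => -[[p|] [q|]]; rewrite [RHS]ffunE //.
  by rewrite (chains1_antisym _ _ c_ch) c_NS oppr0.
by apply: chains1_supp c_ch _; rewrite adj_irr.
Qed.

Fact bar0_subproof (l : 'I_m) : (0 < m.*2.-1)%N.
Proof. by case: l => l /=; lia. Qed.

Fact bar0_end_subproof (l : 'I_m) : (l.*2 < m.*2.-1)%N.
Proof. by case: l => l /=; lia. Qed.

Definition bar0 (l : 'I_m) : bar m :=
  @Bar m (Ordinal (bar0_subproof l)) (Ordinal (bar0_end_subproof l)) (leq0n _).

Lemma in_bar0 l (i : nat) : in_bar (bar0 l) i = (uphalf i <= l)%N.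
Proof. by rewrite /in_bar /=; lia. Qed.

Definition star_bars (s : seq E) : seq (bar m) := [seq bar0 (L e) | e <- s].

(** The recursion follows the fold in [barsum]; the row [const_mx] is empty when the bar misses
    [i]. *)
Fixpoint leaf_coord (s : seq E) i (c : {ffun V * V -> F^o}) :
    barsum F (star_bars s) i :=
  match s return barsum F (star_bars s) i with
  | [::] => 0 : 'rV_0
  | e :: s' => (const_mx (c (leaf_edge e)), leaf_coord s' i c)
  end.

(** The sum over [j] reads the single entry of the row, or gives 0 if the row is empty. *)
Fixpoint triangle_sum (s : seq E) i :
    barsum F (star_bars s) i -> {ffun V * V -> F^o} :=
  match s return barsum F (star_bars s) i -> {ffun V * V -> F^o} with
  | [::] => fun _ => 0
  | e :: s' => fun x =>
      (\sum_j (x.1 : 'rV_(in_bar (bar0 (L e)) i)) 0 j) *: triangle e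
        + triangle_sum (s := s') x.2
  end.

Lemma leaf_coord_is_linear s i : linear (leaf_coord s i).
Proof.
move=> a c d; elim: s => [|e s IH] /=; first by rewrite scaler0 addr0.
rewrite IH; congr (_, _).
by apply/matrixP => u v; rewrite !mxE !ffunE.
Qed.

HB.instance Definition _ s i :=
  GRing.isLinear.Build F _ _ *:%R (leaf_coord s i) (leaf_coord_is_linear s i).

Lemma eq_leaf_coord (s : seq E) i c d :
  {in s, forall e, c (leaf_edge e) = d (leaf_edge e)} ->
  leaf_coord s i c = leaf_coord s i d.
Proof.
elim: s => //= e s IH cd; rewrite cd ?mem_head ?IH // => e' e's.
by rewrite cd // inE e's orbT.
Qed.

Lemma triangle_sum_leaf_edge s i x e :
  e \notin s -> @triangle_sum s i x (leaf_edge e) = 0.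
Proof.
elim: s x => [|e' s IH] x; first by rewrite ffunE.
rewrite inE negb_or => /andP[/negPf ee' /IH es] /=.
by rewrite ffunE es ffunE triangle_leaf_edge ee' scaler0 addr0.
Qed.

Lemma sum_row_bool (b : bool) (x : 'rV[F]_b) (v : 'I_b) :
  \sum_j x 0 j = x 0 v.
Proof.
case: b x v => [x v|x []//].
by rewrite big_ord_recl big_ord0 addr0 (ord1 v).
Qed.

Lemma leaf_coord_triangle_sum s i : uniq s ->
  cancel (@triangle_sum s i) (leaf_coord s i).
Proof.
elim: s => [_ x|e s IH /= /andP[es /IH sK] [x y]].
  by apply/matrixP => u [].
congr (_, _).
  apply/matrixP => u v; rewrite !mxE ord1 ffunE [X in X + _]ffunE.
  rewrite triangle_leaf_edge eqxx.
  by rewrite triangle_sum_leaf_edge // addr0 (sum_row_bool x v) [LHS]mulr1.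
rewrite -[RHS]sK; apply: eq_leaf_coord => e' e's; rewrite ffunE [X in X + _]ffunE.
rewrite triangle_leaf_edge; case: eqP => [e'e|_]; last by rewrite scaler0 add0r.
by rewrite -e'e e's in es.
Qed.

Lemma triangle_sum_in_H1 s i x : {subset s <= D} ->
  @triangle_sum s i x \in H1 F (zgraph star_graph i).
Proof.
elim: s x => [|e s IH] x sD /=; first exact: mem0v.
rewrite rpredD ?IH // => [|e' e's]; last by rewrite sD // inE e's orbT.
have [i_le|i_gt] := leqP (uphalf i) (L e).
  by rewrite rpredZ // triangle_in_H1 ?sD ?mem_head.
(* The triangle is absent at node [i], but then its coefficient is an empty sum. *)
rewrite big1 ?scale0r ?mem0v // => -[j j_lt] _; exfalso; move: j_lt.
by rewrite in_bar0 (leqNgt (uphalf i)) i_gt.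
Qed.

Lemma leaf_coord_inj i :
  {in H1 F (zgraph star_graph i) &, injective (leaf_coord (enum D) i)}.
Proof.
move=> c d cH dH /eqP; rewrite -subr_eq0 -linearB => /eqP cd.
apply/eqP; rewrite -subr_eq0; apply/eqP.
have cdH : c - d \in H1 F (zgraph star_graph i) by rewrite rpredB.
apply: (H1_star_eq0 cdH) => e.
have [/andP[eD i_le]|e_out] := boolP ((e \in D) && (uphalf i <= L e)%N).
  have: e \in enum D by rewrite mem_enum.
  elim: (enum D) cd => //= e' s IH [cde' cds].
  rewrite inE => /orP[/eqP ee'|]; last exact: IH.
  move: cde'; rewrite -ee' => /matrixP/(_ 0).
  by rewrite in_bar0 i_le => /(_ 0); rewrite !mxE.
move: cdH; rewrite memv_cap => /andP[/chains1_supp cd_supp _].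
by apply: cd_supp; rewrite star_zgraph /= eqxx.
Qed.

Lemma leaf_coord_zmap s i j (a : zarrow i j) c :
  c \in H1 F (zgraph star_graph i) -> {subset s <= D} ->
  leaf_coord s j c = zmap (barsum F (star_bars s)) a (leaf_coord s i c).
Proof.
move=> cH; elim: s => //= e s IH sD.
rewrite IH => [|e' e's]; last by rewrite sD // inE e's orbT.
congr (_, _); apply/matrixP => u v; rewrite !mxE /=.
(* The interval map adds [in_bar _ i] copies of the coefficient: one if the bar contains [i],
   otherwise none, and then the edge is absent at [i] and its coefficient is 0. *)
rewrite (eq_bigr (fun=> c (leaf_edge e))) => [|w _]; last by rewrite !mxE mulr1.
rewrite sumr_const card_ord; case i_in: (in_bar _ i); first by rewrite mulr1n.
move: cH; rewrite memv_cap => /andP[/chains1_supp -> //].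
by move: i_in; rewrite star_zgraph /= in_bar0 => ->; rewrite !andbF.
Qed.

Lemma star_barcode :
  is_barcode (H1_zigzag F star_graph) (star_bars (enum D)).
Proof.
have enumD : {subset enum D <= D} by move=> e; rewrite mem_enum.
exists (fun i => leaf_coord (enum D) i \o vsval : {linear subvs_of _ -> _}).
split=> [i|i j a x].
  have sumK x : leaf_coord (enum D) i (vsval (vsproj
      (H1 F (zgraph star_graph i)) (@triangle_sum (enum D) i x))) = x.
    rewrite vsprojK ?triangle_sum_in_H1 //.
    by rewrite leaf_coord_triangle_sum ?enum_uniq.
  exists (fun x => vsproj _ (@triangle_sum (enum D) i x)) => x; last exact: sumK.
  by apply/val_inj/(@leaf_coord_inj i); rewrite ?subvsP //; exact: sumK.
rewrite -leaf_coord_zmap ?subvsP //=; congr (leaf_coord _ _ _).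
exact: (H1_zigzagE a x).
Qed.

Lemma star_barcode_lifetimes B : (0 < m)%N ->
  is_barcode (H1_zigzag F star_graph) B ->
  perm_eq (map (@lifetime m) B) [seq (L e).+1 | e <- enum D].
Proof.
move=> m_gt0 GB; have GB0 := star_barcode.
have eqB i := eq_count_in_bar i GB GB0.
have in_bar_pred i : all (fun b => in_bar b i ==> in_bar b (zpred i)) B.
  have [i0|i_gt0] := posnP i.
    by apply/allT => b; rewrite /= i0 implybb.
  case oi: (odd i).
    apply: (H1_zigzag_barcode_closed GB); rewrite /zarrow oi /= prednK ?eqxx //.
  (* For even [i] the arrow goes from the predecessor to [i]; both nodes have the same dimension, so
     the containment reverses. *)
  apply: all_implyb_count.
    apply: (H1_zigzag_barcode_closed GB); rewrite /zarrow /=; lia.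
  rewrite !eqB /star_bars !count_map; apply: eq_count => e /=.
  by rewrite !in_bar0 /=; lia.
have -> : [seq (L e).+1 | e <- enum D] = map (@lifetime m) (star_bars (enum D)).
  rewrite -map_comp; apply: eq_map => e /=.
  have lt_iff t : (t < m)%N -> (t < lifetime (bar0 (L e)))%N = (t <= L e)%N.
    by move=> t_lt; rewrite lifetime_bstart0 // in_bar0 uphalf_double.
  have := lifetime_le (bar0 (L e)); have := lt_iff _ (ltn_ord (L e)).
  (* Snapshot [(L e).+1] bounds the lifetime if it exists; otherwise the bound [m] does. *)
  have [lt_m|] := ltnP (L e).+1 m; last by rewrite leqnn; lia.
  by have := lt_iff _ lt_m; rewrite leqnn ltnn; lia.
apply: perm_lifetime => //; first exact: all_bstart0.
by rewrite all_map; apply/allT.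
Qed.

End StarWithLeafEdges.

(** * Integer kernel vectors and edges with multiplicities *)

Lemma exists_int_kernel (m k : nat) (A : 'M[rat]_(m, k)) : (k < m)%N ->
  exists d : 'I_m -> int,
    (exists l, d l != 0) /\ forall j, \sum_l (d l)%:~R * A l j = 0.
Proof.
move=> k_lt_m.
have: kermx A != 0.
  rewrite -mxrank_eq0 mxrank_ker subn_eq0 -ltnNge.
  exact: leq_ltn_trans (rank_leq_col A) k_lt_m.
case/rowV0Pn => v /sub_kermxP vA v_neq0.
(* This is [v 0 l] times the product of all denominators. *)
exists (fun l => numq (v 0 l) * \prod_(i | i != l) denq (v 0 i)); split.
  have [l vl] : exists l, v 0 l != 0.
    apply/existsP; apply: contraNT v_neq0; rewrite negb_exists => /forallP v0.
    by apply/eqP/rowP => l; rewrite mxE; apply/eqP; have := v0 l; rewrite negbK.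
  exists l; rewrite mulf_neq0 ?numq_eq0 //.
  by apply/prodf_neq0 => i _; apply: denq_neq0.
move=> j; have /rowP/(_ j) := vA; rewrite !mxE.
move=> /(congr1 (fun x => (\prod_i denq (v 0 i))%:~R * x)).
rewrite mulr0 mulr_sumr => vAj; rewrite -[RHS]vAj; apply: eq_bigr => l _.
rewrite mulrA; congr (_ * _); rewrite [in RHS](bigD1 l) //= !rmorphM /= mulrAC.
by congr (_ * _); rewrite numqE mulrC.
Qed.

(** The value [c l] becomes a number of edges labelled [l]; a fixed [N] keeps the edge type
    independent of [c]. *)
Definition copies (m N : nat) (c : 'I_m -> nat) : {set 'I_m * 'I_N} :=
  [set e : 'I_m * 'I_N | (e.2 < c e.1)%N].

Lemma big_copies (R : Type) (idx : R) (op : Monoid.com_law idx) (m N : nat)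
    (c : 'I_m -> nat) (f : 'I_m -> R) : (forall l, c l <= N)%N ->
  \big[op/idx]_(e <- enum (copies N c)) f e.1 =
  \big[op/idx]_l iter (c l) (op (f l)) idx.
Proof.
move=> cN; rewrite big_enum.
rewrite (eq_bigl (fun e : 'I_m * 'I_N => e.2 < c e.1)%N) => [|e]; last first.
  by rewrite inE.
rewrite -(pair_big_dep xpredT (fun l (n : 'I_N) => n < c l)%N (fun l n => f l)) /=.
apply: eq_bigr => l _; rewrite -big_const_ord.
by rewrite (big_ord_widen _ (fun=> f l) (cN l)).
Qed.

Section Copies.
Variables (m N : nat) (c : 'I_m -> nat) (B : seq (bar m)).
Hypotheses (cN : (forall l, c l <= N)%N)
  (Bc : perm_eq (map (@lifetime m) B)
    [seq e.1.+1 | e : 'I_m * 'I_N <- enum (copies N c)]).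

Lemma weight_sum_copies phi :
  weight_sum phi B = \sum_(l < m) phi.[l.+1%:R / m%:R] *+ c l.
Proof.
rewrite /weight_sum -(big_map (@lifetime m) xpredT (fun l => phi.[l%:R / m%:R])).
rewrite (perm_big _ Bc) big_map.
rewrite (big_copies _ (fun l : 'I_m => phi.[l.+1%:R / m%:R]) cN).
by apply: eq_bigr => l _; rewrite iter_addr_0.
Qed.

Lemma histogram_copies l : tnth (pos_histogram B) l = c l.
Proof.
rewrite tnth_mktuple -[LHS](count_map (@lifetime m) (pred1 l.+1)).
rewrite (permP Bc) count_map -sum1_count big_mkcond /=.
rewrite (big_copies _ (fun l' : 'I_m => if l'.+1 == l.+1 then 1%N else 0%N) cN).
rewrite (bigD1 l) //= eqxx iter_addn_0 mul1n big1 ?addn0 // => i.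
by rewrite eqSS iter_addn_0 (inj_eq val_inj) => /negPf->.
Qed.

End Copies.

Theorem theorem8p1 (F : fieldType) (m k : nat) (phi : 'I_k -> {poly rat})
    (m_ge2 : (2 <= m)%N) (k_lt_m : (k < m)%N)
    (phi_weight : forall j, pgf_weight (phi j)) :
  exists (V : finType) (G G' : 'I_m -> sgraph V),
    [/\ (exists c : V, forall t : 'I_m,
           spanning_star_in c (G t) /\ spanning_star_in c (G' t)),
        (exists B, is_barcode (H1_zigzag F G) B),
        (exists B', is_barcode (H1_zigzag F G') B') &
        forall B B' : seq (bar m),
          is_barcode (H1_zigzag F G) B -> is_barcode (H1_zigzag F G') B' ->
          pos_histogram B <> pos_histogram B' /\
          (forall j, weight_sum (phi j) B = weight_sum (phi j) B')].
Proof.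
have [d [[l0 dl0] dA]] := exists_int_kernel
  (\matrix_(l < m, j < k) (phi j).[l.+1%:R / m%:R]) k_lt_m.
pose dp l := if 0 <= d l then `|d l|%N else 0%N.
pose dn l := if 0 <= d l then 0%N else `|d l|%N.
pose N := (\sum_l `|d l|)%N.
have dN l : (`|d l| <= N)%N by rewrite /N (bigD1 l) //= leq_addr.
have dpN l : (dp l <= N)%N by rewrite /dp; case: ifP.
have dnN l : (dn l <= N)%N by rewrite /dn; case: ifP.
pose G (c : 'I_m -> nat) := star_graph (copies N c) (fun e => e.1).
have m_gt0 : (0 < m)%N by apply: leq_trans m_ge2.
exists (star_vertex ('I_m * 'I_N)%type), (G dp), (G dn); split.
- by exists None => t; split=> -[].
- by eexists; apply: star_barcode.
- by eexists; apply: star_barcode.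
move=> B B' /(star_barcode_lifetimes m_gt0) Bp
  /(star_barcode_lifetimes m_gt0) Bn.
split=> [eqBB'|j].
  (* One of the two parts vanishes at [l0], so their equality would give [d l0 = 0]. *)
  have: dp l0 = dn l0.
    by rewrite -(histogram_copies dpN Bp) -(histogram_copies dnN Bn) eqBB'.
  move: dl0; rewrite -absz_eq0 /dp /dn.
  by case: ifP => _ /eqP dl0 dE; case: dl0; rewrite dE.
rewrite (weight_sum_copies dpN Bp) (weight_sum_copies dnN Bn).
(* Since [dp - dn = d], the difference of the weight sums is the pairing of [d] with column [j]. *)
apply/eqP; rewrite -subr_eq0 -sumrB -[X in _ == X](dA j); apply/eqP.
apply: eq_bigr => l _; rewrite mxE.
rewrite -[_ *+ dp l]mulr_natl -[_ *+ dn l]mulr_natl -mulrBl; congr (_ * _).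
by rewrite /dp /dn; case: (d l) => n /=; rewrite ?subr0 ?sub0r.
Qed.
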